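(* Let $A\in\mathbb{R}^{m\times n}$ and $R_\theta\in\mathbb{R}^{m\times d}$, and let $k=\min(n,d)$. Then $$\mu(A,R_\theta)=\max_{\substack{P^TP=I_k\\ Q^TQ=I_k}}\left(\sum_{i=1}^k \mu^2(Ap_i,R_\theta q_i)\right)^{1/2},$$ where the maximum is over all $P=[p_1,\ldots,p_k]\in\mathbb{R}^{n\times k}$ and $Q=[q_1,\ldots,q_k]\in\mathbb{R}^{d\times k}$ with orthonormal columns.
   Context: Here $m,n,d$ are positive integers. For real matrices $A\in\mathbb{R}^{m\times n}$ and $R\in\mathbb{R}^{m\times d}$ with the same number of rows, define the backward error $$\mu(A,R)=\min_Y\left(\|YY^\dagger A\|_F^2+\|(I-YY^\dagger)R\|_F^2\right)^{1/2},$$ where $Y$ ranges over all real matrices with $m$ rows (any number of columns), $Y^\dagger$ is the Moore-Penrose inverse of $Y$ (so $YY^\dagger$ ranges over all orthogonal projectors on $\mathbb{R}^m$), and $\|\cdot\|_F$ is the Frobenius norm. For vectors $a,r\in\mathbb{R}^m$, $\mu(a,r)$ is defined by viewing $a,r$ as $m\times 1$ matrices. $\mu^2(\cdot,\cdot)$ denotes the square of $\mu(\cdot,\cdot)$. *)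

(* Defs.v *)
From HB Require Import structures.
From mathcomp Require Import all_boot all_order all_algebra.
From mathcomp Require Import all_classical all_reals all_analysis.

Set Implicit Arguments.
Unset Strict Implicit.
Unset Printing Implicit Defensive.

Import Order.TTheory GRing.Theory Num.Theory numFieldNormedType.Exports.

Local Open Scope classical_set_scope.
Local Open Scope ring_scope.

Definition is_minimum (R : realType) (S : set R) (x : R) : Prop :=
  S x /\ lbound S x.

Definition is_maximum (R : realType) (S : set R) (x : R) : Prop :=
  S x /\ ubound S x.

Definition frob (R : realType) (m n : nat) (A : 'M[R]_(m, n)) : R :=
  Num.sqrt (\sum_(i < m) \sum_(j < n) A i j ^+ 2).

Definition penrose (R : realType) (m p : nat)
    (Y : 'M[R]_(m, p)) (X : 'M[R]_(p, m)) : Prop :=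
  [/\ Y *m X *m Y = Y,
      X *m Y *m X = X,
      (Y *m X)^T = Y *m X &
      (X *m Y)^T = X *m Y].

(* The default value 0 is never taken: see [pinvP]. *)
Definition pinv (R : realType) (m p : nat) (Y : 'M[R]_(m, p)) : 'M[R]_(p, m) :=
  xget 0 [set X | penrose Y X].

Definition mu_objective (R : realType) (m n d p : nat)
    (A : 'M[R]_(m, n)) (B : 'M[R]_(m, d)) (Y : 'M[R]_(m, p)) : R :=
  Num.sqrt (frob (Y *m pinv Y *m A) ^+ 2
            + frob ((1%:M - Y *m pinv Y) *m B) ^+ 2).

Definition mu_values (R : realType) (m n d : nat)
    (A : 'M[R]_(m, n)) (B : 'M[R]_(m, d)) : set R :=
  [set x | exists p (Y : 'M[R]_(m, p)), x = mu_objective A B Y].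

(* This infimum is a minimum: see [mu_min]. *)
Definition mu (R : realType) (m n d : nat)
    (A : 'M[R]_(m, n)) (B : 'M[R]_(m, d)) : R :=
  inf (mu_values A B).

Lemma row_sqr_eq0 (R : realType) (n : nat) (u : 'rV[R]_n) :
  u *m u^T = 0 -> u = 0.
Proof.
move=> /matrixP /(_ 0 0); rewrite !mxE => /eqP.
rewrite psumr_eq0 => [|j _]; last by rewrite mxE -expr2 sqr_ge0.
move=> /allP u0; apply/rowP => j; rewrite mxE; apply/eqP.
by have := u0 j (mem_index_enum j); rewrite mxE mulf_eq0 orbb.
Qed.

Lemma gram_unit (R : realType) (r n : nat) (F : 'M[R]_(r, n)) :
  row_free F -> F *m F^T \in unitmx.
Proof.
move=> Ffree; rewrite -row_free_unit; apply: inj_row_free => v v0.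
apply: (row_free_inj Ffree); rewrite mul0mx; apply: row_sqr_eq0.
by rewrite trmx_mul !mulmxA -(mulmxA v) v0 mul0mx.
Qed.

Lemma penrose_exists (R : realType) (m p : nat) (Y : 'M[R]_(m, p)) :
  exists X, penrose Y X.
Proof.
have := col_base_full Y; have := row_base_free Y; have := mulmx_base Y.
move: (\rank Y) (col_base Y) (row_base Y) => r C F YE Ffree Cfull.
have FU : F *m F^T \in unitmx by exact: gram_unit.
have CU : C^T *m C \in unitmx.
  rewrite -[C in X in _ *m X]trmxK; apply: gram_unit.
  by rewrite /row_free mxrank_tr.
set G := invmx (F *m F^T); set H := invmx (C^T *m C).
have FG : F *m F^T *m G = 1%:M by rewrite mulmxV.
have HC : H *m C^T *m C = 1%:M by rewrite -mulmxA mulVmx.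
have GT : G^T = G by rewrite trmx_inv trmx_mul trmxK.
have HT : H^T = H by rewrite trmx_inv trmx_mul trmxK.
exists (F^T *m G *m (H *m C^T)).
have YX : Y *m (F^T *m G *m (H *m C^T)) = C *m H *m C^T.
  by rewrite -YE !mulmxA -(mulmxA C F) -(mulmxA C _ G) FG mulmx1.
have XY : F^T *m G *m (H *m C^T) *m Y = F^T *m G *m F.
  by rewrite -YE -[LHS]mulmxA (mulmxA _ C F) HC mul1mx.
split; rewrite ?YX ?XY.
- by rewrite -YE -!mulmxA (mulmxA C^T) (mulmxA H) [H *m _]mulmxA HC mul1mx.
- by rewrite -!mulmxA (mulmxA F) (mulmxA (F *m F^T)) FG mul1mx.
- by rewrite !trmx_mul trmxK HT mulmxA.
- by rewrite !trmx_mul trmxK GT mulmxA.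
Qed.

Lemma pinvP (R : realType) (m p : nat) (Y : 'M[R]_(m, p)) : penrose Y (pinv Y).
Proof.
by rewrite /pinv; have [X XP] := penrose_exists Y; apply: (xgetPex 0); exists X.
Qed.

Lemma penrose_unique (R : realType) (m p : nat) (Y : 'M[R]_(m, p))
    (X Z : 'M[R]_(p, m)) : penrose Y X -> penrose Y Z -> X = Z.
Proof.
move=> [X1 X2 X3 X4] [Z1 Z2 Z3 Z4].
have E1 : Y *m X = Y *m Z.
  by rewrite -X3 -{1}Z1 -[_ *m Y *m X]mulmxA trmx_mul X3 Z3 mulmxA X1.
have E2 : X *m Y = Z *m Y.
  rewrite -X4 -{1}Z1 !mulmxA -(mulmxA X Y Z) -(mulmxA X).
  by rewrite -!mulmxA (mulmxA X) trmx_mul X4 Z4 -!mulmxA (mulmxA Y) X1.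
by rewrite -X2 -mulmxA E1 mulmxA E2 Z2.
Qed.

Definition projector (R : realType) (m : nat) (P : 'M[R]_m) : Prop :=
  P^T = P /\ P *m P = P.

Lemma pinv_projector (R : realType) (m p : nat) (Y : 'M[R]_(m, p)) :
  projector (Y *m pinv Y).
Proof. by have [H1 H2 H3 H4] := pinvP Y; split; rewrite // mulmxA H1. Qed.

Lemma projector_pinv (R : realType) (m : nat) (P : 'M[R]_m) :
  projector P -> P *m pinv P = P.
Proof.
move=> [PT PP]; suff -> : pinv P = P by [].
by apply: (penrose_unique (pinvP P)); split; rewrite ?PP.
Qed.

Lemma projector_entry (R : realType) (m : nat) (P : 'M[R]_m) i j :
  projector P -> `|P i j| <= 1.
Proof.
move=> [PT PP].
have E : P i i = \sum_k P i k ^+ 2.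
  rewrite -{1}PP mxE; apply: eq_bigr => k _.
  by rewrite expr2 -{2}PT mxE.
have le k : P i k ^+ 2 <= P i i.
  rewrite E (bigD1 k) //= lerDl; apply: sumr_ge0 => l _; exact: sqr_ge0.
have Pii : P i i <= 1.
  have := le i; case: (lerP (P i i) 0) => [/le_trans -> //|Pp].
  by rewrite expr2 ger_pMr.
rewrite -(@ler_pXn2r _ 2) ?nnegrE // expr1n real_normK ?num_real //.
exact: le_trans (le j) Pii.
Qed.

Lemma frob_sqr (R : realType) (m n : nat) (A : 'M[R]_(m, n)) :
  frob A ^+ 2 = \sum_(i < m) \sum_(j < n) A i j ^+ 2.
Proof.
rewrite sqr_sqrtr //; apply: sumr_ge0 => i _; apply: sumr_ge0 => j _.
exact: sqr_ge0.
Qed.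

Lemma continuous_sumR (R : realType) (T : topologicalType) (n : nat)
    (f : 'I_n -> T -> R) :
  (forall i, continuous (f i)) -> continuous (fun x => \sum_(i < n) f i x).
Proof.
move=> fc; apply: (continuous_big _ _) => [|i _]; last exact: fc.
exact: add_continuous.
Qed.

Lemma continuous_addR (R : realType) (T : topologicalType) (f g : T -> R) :
  continuous f -> continuous g -> continuous (fun x => f x + g x).
Proof. by move=> fc gc x; apply: cvgD; [exact: fc|exact: gc]. Qed.

Definition continuous_mx (R : realType) (T : topologicalType) (m n : nat)
    (F : T -> 'M[R]_(m, n)) : Prop := forall i j, continuous (fun x => F x i j).

Lemma continuous_mulmx (R : realType) (T : topologicalType) (m n p : nat)
    (F : T -> 'M[R]_(m, n)) (G : T -> 'M[R]_(n, p)) :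
  continuous_mx F -> continuous_mx G -> continuous_mx (fun x => F x *m G x).
Proof.
move=> Fc Gc i j; under eq_fun do rewrite mxE.
by apply: continuous_sumR => k x; apply: cvgM; [exact: Fc|exact: Gc].
Qed.

Lemma continuous_sub (R : realType) (T : topologicalType) (m n : nat)
    (F G : T -> 'M[R]_(m, n)) :
  continuous_mx F -> continuous_mx G -> continuous_mx (fun x => F x - G x).
Proof.
move=> Fc Gc i j; under eq_fun do rewrite !mxE.
by move=> x; apply: cvgB; [exact: Fc|exact: Gc].
Qed.

Lemma continuous_frob_sqr (R : realType) (T : topologicalType) (m n : nat)
    (F : T -> 'M[R]_(m, n)) :
  continuous_mx F -> continuous (fun x => frob (F x) ^+ 2).
Proof.
move=> Fc; under eq_fun do rewrite frob_sqr.
apply: continuous_sumR => i; apply: continuous_sumR => j x.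
by apply: cvgM; exact: Fc.
Qed.

Lemma closed_mx0 (R : realType) (T : topologicalType) (m n : nat)
    (F : T -> 'M[R]_(m, n)) : continuous_mx F -> closed [set x | F x = 0].
Proof.
move=> Fc.
have -> : [set x | F x = 0] = (fun x => frob (F x) ^+ 2) @^-1` [set y | y = 0].
  apply/seteqP; split=> x /=; rewrite frob_sqr.
    by move=> ->; rewrite big1 // => i _; rewrite big1 // => j _; rewrite mxE expr0n.
  move=> /eqP; rewrite psumr_eq0 => [/allP H|i _]; last first.
    by apply: sumr_ge0 => j _; exact: sqr_ge0.
  apply/matrixP => i j; rewrite mxE; apply/eqP.
  have := H i (mem_index_enum i); rewrite /= psumr_eq0 => [/allP H'|k _].
    by have := H' j (mem_index_enum j); rewrite /= sqrf_eq0.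
  exact: sqr_ge0.
apply: preimage_closed; last exact: closed_eq.
by move=> x _; exact: continuous_frob_sqr.
Qed.

Lemma continuous_vec_mx (R : realType) (m n : nat) :
  continuous_mx (fun v : 'rV[R]_(m * n) => vec_mx v).
Proof. by move=> i j; under eq_fun do rewrite mxE; exact: coord_continuous. Qed.

Lemma continuous_mx_cst (R : realType) (T : topologicalType) (m n : nat)
    (A : 'M[R]_(m, n)) : continuous_mx (fun _ : T => A).
Proof. by move=> i j x; exact: cvg_cst. Qed.

Lemma compact_projector (R : realType) (m : nat) :
  compact [set v : 'rV[R]_(m * m) | projector (vec_mx v)].
Proof.
apply: bounded_closed_compact.
  exists 1; split=> [|M M1 v /= Pv]; first exact: num_real.
  apply: le_trans (ltW M1); rewrite [leLHS]/Num.norm /= mx_normrE.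
  apply/bigmax_leP; split=> // -[i j] _ /=; rewrite ord1.
  by case/mxvec_indexP: j => a b; have := projector_entry a b Pv; rewrite mxE.
have -> : [set v : 'rV[R]_(m * m) | projector (vec_mx v)] =
   [set v | (vec_mx v)^T - vec_mx v = 0] `&`
   [set v | vec_mx v *m vec_mx v - vec_mx v = 0].
  by apply/seteqP; split=> v /= [/eqP H1 /eqP H2]; split; apply/eqP;
    rewrite ?subr_eq0 // -subr_eq0.
have vc := @continuous_vec_mx R m m.
apply: closedI; apply: closed_mx0; apply: continuous_sub => //.
  by move=> i j; under eq_fun do rewrite mxE; exact: vc.
exact: continuous_mulmx.
Qed.

Lemma mu_min (R : realType) (m n d : nat)
    (A : 'M[R]_(m, n)) (B : 'M[R]_(m, d)) :
  is_minimum (mu_values A B) (mu A B).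
Proof.
pose g (P : 'M[R]_m) := frob (P *m A) ^+ 2 + frob ((1%:M - P) *m B) ^+ 2.
have [c cP cmin] : exists2 P, projector P & forall Q, projector Q -> g P <= g Q.
  have [||| v] := @EVT_min_rV R _ (fun v => g (vec_mx v))
                 [set v : 'rV[R]_(m * m) | projector (vec_mx v)].
  - by exists 0; split; rewrite linear0 ?trmx0 ?mul0mx.
  - exact: compact_projector.
  - apply: continuous_subspaceT.
    have vc := @continuous_vec_mx R m m.
    have c1 : continuous (fun v : 'rV[R]_(m * m) => frob (vec_mx v *m A) ^+ 2).
      apply/continuous_frob_sqr/continuous_mulmx => //.
      exact: continuous_mx_cst.
    have c2 : continuous (fun v : 'rV[R]_(m * m) =>
                            frob ((1%:M - vec_mx v) *m B) ^+ 2).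
      apply/continuous_frob_sqr/continuous_mulmx; last exact: continuous_mx_cst.
      by apply: continuous_sub => //; exact: continuous_mx_cst.
    exact: (continuous_addR c1 c2).
  - rewrite inE => vP vmin; exists (vec_mx v) => // Q QP.
    by have := vmin (mxvec Q); rewrite inE /= mxvecK; apply.
have lb : lbound (mu_values A B) (mu_objective A B c).
  move=> _ [p [Y ->]]; rewrite /mu_objective ler_wsqrtr // -!/(g _) projector_pinv //.
  exact/cmin/pinv_projector.
have cin : mu_values A B (mu_objective A B c) by exists m, c.
suff -> : mu A B = mu_objective A B c by [].
apply/eqP; rewrite eq_le; apply/andP; split.
  by apply: ge_inf => //; exists (mu_objective A B c).
by apply: lb_le_inf => //; exists (mu_objective A B c).
Qed.

(* Main.v *)
Require Import Defs.
From mathcomp Require Import all_boot all_order all_algebra.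
From mathcomp Require Import all_classical all_reals all_analysis.
From mathcomp Require Import ring lra.

(** Write [H] for an orthogonal projector and [H' = 1 - H].

    That no choice of [P] and [Q] exceeds [mu A B] is immediate: take [H]
    optimal for [(A, B)] and use it for every pair [(A p_i, B q_i)].  The sum of
    the resulting values is [|HAP|^2 + |H'BQ|^2], and multiplying on the right by
    a matrix with orthonormal columns does not increase the Frobenius norm
    ([sum_mu_le]).

    For equality, put [S = A A^T - B B^T].  Up to the constant [|B|^2] the
    objective at [H] is [tr (H S)], so a minimizer [H] makes [S] nonpositive on
    the range of [H], nonnegative on its kernel, and decouples the two
    ([optimal_signature]).  With [A1 = HA], [B1 = HB], [A2 = H'A], [B2 = H'B] this
    reads [A1 A1^T <= B1 B1^T], [B2 B2^T <= A2 A2^T] and [A1 A2^T = B1 B2^T].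
    These are the hypotheses under which a single contraction [C] satisfies both
    [A1 = B1 C] and [B2 = A2 C^T] ([parrott], [optimal_contraction]).  A singular
    value decomposition [C = Q diag(s) P^T] ([svd]) provides the required [P] and
    [Q]: the pair [(A p_i, B q_i)] has the form [(s_i r1 + a2, r1 + s_i a2)] with
    [r1] in the range of [H], [a2] in its kernel and [|s_i| <= 1].  For such a
    pair [H] is itself an optimal projector ([mu_pair_ge]), and since [HA] has
    its row space in the range of [P], and [H'B] in that of [Q], the values add
    up to [|HA|^2 + |H'B|^2] ([sum_mu_attained]). *)

Set Implicit Arguments.
Unset Strict Implicit.
Unset Printing Implicit Defensive.

(* The last import restores [pinv] as the Moore-Penrose inverse, as opposed to
   the partial inverse of a function. *)
Import Order.TTheory GRing.Theory Num.Theory numFieldNormedType.Exports Defs.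

Local Open Scope classical_set_scope.
Local Open Scope ring_scope.

(** * The trace inner product *)

Definition ip (R : realType) (m n : nat) (A B : 'M[R]_(m, n)) : R :=
  \tr (A^T *m B).

Lemma ipE (R : realType) (m n : nat) (A B : 'M[R]_(m, n)) :
  ip A B = \sum_(j < n) \sum_(i < m) A i j * B i j.
Proof.
rewrite /ip /mxtrace; apply: eq_bigr => j _; rewrite mxE.
by apply: eq_bigr => i _; rewrite mxE.
Qed.

Lemma frob_ip (R : realType) (m n : nat) (A : 'M[R]_(m, n)) :
  frob A ^+ 2 = ip A A.
Proof.
by rewrite frob_sqr exchange_big ipE; apply: eq_bigr => j _; apply: eq_bigr.
Qed.

Lemma ip_col (R : realType) (m n : nat) (A : 'M[R]_(m, n)) :
  ip A A = \sum_(j < n) ip (col j A) (col j A).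
Proof.
rewrite ipE; apply: eq_bigr => j _; rewrite ipE big_ord1.
by apply: eq_bigr => i _; rewrite mxE.
Qed.

Lemma ip_ge0 (R : realType) (m n : nat) (A : 'M[R]_(m, n)) : 0 <= ip A A.
Proof. by rewrite -frob_ip sqr_ge0. Qed.

Lemma ip_eq0 (R : realType) (m n : nat) (A : 'M[R]_(m, n)) :
  (ip A A == 0) = (A == 0).
Proof.
apply/eqP/eqP => [|->]; last by rewrite /ip mulmx0 raddf0.
rewrite ipE => /eqP; rewrite psumr_eq0 => [/allP A0|j _]; last first.
  by apply: sumr_ge0 => i _; rewrite -expr2 sqr_ge0.
apply/matrixP => i j; rewrite mxE; apply/eqP.
have := A0 j (mem_index_enum j); rewrite /= psumr_eq0 => [/allP A1|k _].
  by have := A1 i (mem_index_enum i); rewrite /= mulf_eq0 orbb.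
by rewrite -expr2 sqr_ge0.
Qed.

Lemma ip_gt0 (R : realType) (m n : nat) (A : 'M[R]_(m, n)) :
  (0 < ip A A) = (A != 0).
Proof. by rewrite lt0r ip_eq0 ip_ge0 andbT. Qed.

Lemma ipC (R : realType) (m n : nat) (A B : 'M[R]_(m, n)) : ip A B = ip B A.
Proof. by rewrite /ip -mxtrace_tr trmx_mul trmxK. Qed.

Lemma ipDr (R : realType) (m n : nat) (A B C : 'M[R]_(m, n)) :
  ip A (B + C) = ip A B + ip A C.
Proof. by rewrite /ip mulmxDr raddfD. Qed.

Lemma ipNr (R : realType) (m n : nat) (A B : 'M[R]_(m, n)) :
  ip A (- B) = - ip A B.
Proof. by rewrite /ip mulmxN raddfN. Qed.

Lemma ipZr (R : realType) (m n : nat) (c : R) (A B : 'M[R]_(m, n)) :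
  ip A (c *: B) = c * ip A B.
Proof. by rewrite /ip -scalemxAr mxtraceZ. Qed.

Lemma ipDl (R : realType) (m n : nat) (A B C : 'M[R]_(m, n)) :
  ip (A + B) C = ip A C + ip B C.
Proof. by rewrite ![ip _ C]ipC ipDr. Qed.

Lemma ipNl (R : realType) (m n : nat) (A B : 'M[R]_(m, n)) :
  ip (- A) B = - ip A B.
Proof. by rewrite ![ip _ B]ipC ipNr. Qed.

Lemma ipZl (R : realType) (m n : nat) (c : R) (A B : 'M[R]_(m, n)) :
  ip (c *: A) B = c * ip A B.
Proof. by rewrite ![ip _ B]ipC ipZr. Qed.

Lemma ip0r (R : realType) (m n : nat) (A : 'M[R]_(m, n)) : ip A 0 = 0.
Proof. by rewrite /ip mulmx0 raddf0. Qed.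

Lemma ip_adjl (R : realType) (m n p : nat) (C : 'M[R]_(p, m))
    (A : 'M[R]_(m, n)) (B : 'M[R]_(p, n)) :
  ip (C *m A) B = ip A (C^T *m B).
Proof. by rewrite /ip trmx_mul mulmxA. Qed.

Lemma ip_adjr (R : realType) (m n p : nat) (C : 'M[R]_(n, p))
    (A : 'M[R]_(m, n)) (B : 'M[R]_(m, p)) :
  ip (A *m C) B = ip A (B *m C^T).
Proof. by rewrite /ip trmx_mul -mulmxA mxtrace_mulC mulmxA. Qed.

Lemma mul_col_ip (R : realType) (m : nat) (x y : 'cV[R]_m) :
  x^T *m y = (ip x y)%:M.
Proof. by rewrite [LHS]mx11_scalar /ip trace_mx11. Qed.

(** The source of all first-order conditions below: near [t = 0] the linear term
    dominates, so it cannot be present. *)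
Lemma sqr_poly_ge0 (R : realType) (b c : R) :
  (forall t, 0 <= 2 * t * b + t ^+ 2 * c) -> b = 0.
Proof.
move=> H; apply/eqP; apply/negPn/negP => b0.
have c1 : 0 < 1 + c ^+ 2 by nra.
(* Any step of sign opposite to [b] and size below [2 |b| / c] makes the
   polynomial negative; [1 + c ^ 2] exceeds [c / 2] whatever the sign of [c]. *)
have := H (- b / (1 + c ^+ 2)).
have -> : 2 * (- b / (1 + c ^+ 2)) * b + (- b / (1 + c ^+ 2)) ^+ 2 * c =
   - (b / (1 + c ^+ 2)) ^+ 2 * (2 + 2 * c ^+ 2 - c).
  by field; rewrite gt_eqF.
have h1 : 0 < (b / (1 + c ^+ 2)) ^+ 2.
  by rewrite exprn_even_gt0 //= mulf_neq0 ?b0 // invr_eq0 gt_eqF.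
nra.
Qed.

(** * First-order conditions for the optimal projector *)

Definition proj_objective (R : realType) (m n d : nat)
    (A : 'M[R]_(m, n)) (B : 'M[R]_(m, d)) (H : 'M[R]_m) : R :=
  ip (H *m A) (H *m A) + ip ((1%:M - H) *m B) ((1%:M - H) *m B).

Lemma mu_objectiveE (R : realType) (m n d p : nat)
    (A : 'M[R]_(m, n)) (B : 'M[R]_(m, d)) (Y : 'M[R]_(m, p)) :
  mu_objective A B Y = Num.sqrt (proj_objective A B (Y *m pinv Y)).
Proof. by rewrite /mu_objective !frob_ip. Qed.

Lemma proj_objective_ge0 (R : realType) (m n d : nat)
    (A : 'M[R]_(m, n)) (B : 'M[R]_(m, d)) (H : 'M[R]_m) :
  0 <= proj_objective A B H.
Proof. by rewrite addr_ge0 ?ip_ge0. Qed.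

Lemma mu_ge0 (R : realType) (m n d : nat)
    (A : 'M[R]_(m, n)) (B : 'M[R]_(m, d)) : 0 <= mu A B.
Proof. by have [[p [Y ->]] _] := mu_min A B; exact: sqrtr_ge0. Qed.

Lemma mu_le_objective (R : realType) (m n d : nat)
    (A : 'M[R]_(m, n)) (B : 'M[R]_(m, d)) (H : 'M[R]_m) :
  projector H -> mu A B ^+ 2 <= proj_objective A B H.
Proof.
move=> PH; have [_ lb] := mu_min A B.
have : mu A B <= mu_objective A B H by apply: lb; exists m, H.
rewrite mu_objectiveE projector_pinv // => le.
by rewrite -(sqr_sqrtr (proj_objective_ge0 A B H)) ler_pXn2r ?nnegrE ?mu_ge0.
Qed.

Lemma mu_attained (R : realType) (m n d : nat)
    (A : 'M[R]_(m, n)) (B : 'M[R]_(m, d)) :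
  exists2 H, projector H & mu A B ^+ 2 = proj_objective A B H.
Proof.
have [[p [Y ->]] _] := mu_min A B; exists (Y *m pinv Y).
  exact: pinv_projector.
by rewrite mu_objectiveE sqr_sqrtr ?proj_objective_ge0.
Qed.

Lemma projector_compl (R : realType) (m : nat) (H : 'M[R]_m) :
  projector H -> projector (1%:M - H).
Proof.
move=> [HT HH]; split; first by rewrite raddfB /= trmx1 HT.
by rewrite mulmxBr mulmx1 mulmxBl mul1mx HH subrr subr0.
Qed.

Lemma ip_projector (R : realType) (m n : nat) (H : 'M[R]_m) (A : 'M[R]_(m, n)) :
  projector H -> ip (H *m A) (H *m A) = \tr (H *m (A *m A^T)).
Proof.
by move=> [HT HH]; rewrite ip_adjl HT mulmxA HH /ip mxtrace_mulC mulmxA.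
Qed.

(** On projectors the objective is affine, which makes the effect of rank-one
    updates of [H] explicit. *)
Lemma proj_objectiveE (R : realType) (m n d : nat)
    (A : 'M[R]_(m, n)) (B : 'M[R]_(m, d)) (H : 'M[R]_m) :
  projector H ->
  proj_objective A B H = ip B B + \tr (H *m (A *m A^T - B *m B^T)).
Proof.
move=> PH; rewrite /proj_objective !ip_projector //; last exact: projector_compl.
have -> : ip B B = \tr (B *m B^T) by exact: mxtrace_mulC.
by rewrite mulmxBl mul1mx mulmxBr !raddfB /=; ring.
Qed.

Lemma trace_rank1 (R : realType) (m : nat) (c : R) (x : 'cV[R]_m) (S : 'M[R]_m) :
  \tr (c *: (x *m x^T) *m S) = c * ip x (S *m x).
Proof.
by rewrite -scalemxAl mxtraceZ /ip -mulmxA mxtrace_mulC mulmxA.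
Qed.

Lemma projector_add1 (R : realType) (m : nat) (H : 'M[R]_m) (x : 'cV[R]_m) :
  projector H -> H *m x = 0 -> x != 0 ->
  projector (H + (ip x x)^-1 *: (x *m x^T)).
Proof.
move=> [HT HH] Hx x0.
have xH : x^T *m H = 0 by rewrite -HT -trmx_mul Hx trmx0.
split; first by rewrite raddfD /= linearZ /= trmx_mul trmxK HT.
rewrite mulmxDl !mulmxDr HH -!scalemxAr -!scalemxAl !mulmxA Hx mul0mx scaler0.
rewrite -(mulmxA x) xH mulmx0 scaler0 addr0 add0r.
rewrite -(mulmxA x) mul_col_ip mul_mx_scalar -scalemxAl [in X in _ + X]scalerA.
by rewrite scalerA divfK ?ip_eq0.
Qed.

Lemma projector_sub1 (R : realType) (m : nat) (H : 'M[R]_m) (x : 'cV[R]_m) :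
  projector H -> H *m x = x -> x != 0 ->
  projector (H - (ip x x)^-1 *: (x *m x^T)).
Proof.
move=> PH Hx x0; have PC := projector_compl PH.
have := projector_compl (projector_add1 PC _ x0).
rewrite opprD opprB addrA addrCA subrr addr0; apply.
by rewrite mulmxBl mul1mx Hx subrr.
Qed.

(** Each conclusion compares [H] with a rank-one modification of it: removing
    the line of [u] from its range, adding the line of [v], and replacing the line
    of [u] by that of [u + t v].  In the last case optimality says that the Rayleigh
    quotient of [S] on the plane spanned by [u] and [v] is smallest at [u]; its
    derivative there in the direction [v] is a multiple of [ip u (S *m v)]. *)
Lemma optimal_signature (R : realType) (m : nat) (H S : 'M[R]_m) :
  projector H -> S^T = S ->
  (forall K, projector K -> \tr (H *m S) <= \tr (K *m S)) ->
  [/\ forall u : 'cV_m, H *m u = u -> ip u (S *m u) <= 0,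
      forall v : 'cV_m, H *m v = 0 -> 0 <= ip v (S *m v) &
      forall u v : 'cV_m, H *m u = u -> H *m v = 0 -> ip u (S *m v) = 0].
Proof.
move=> PH ST opt; split.
- move=> u Hu; have [->|u0] := eqVneq u 0; first by rewrite mulmx0 ip0r.
  have := opt _ (projector_sub1 PH Hu u0).
  rewrite mulmxBl raddfB /= trace_rank1 lerBrDr gerDl pmulr_rle0 //.
  by rewrite invr_gt0 ip_gt0.
- move=> v Hv; have [->|v0] := eqVneq v 0; first by rewrite mulmx0 ip0r.
  have := opt _ (projector_add1 PH Hv v0).
  rewrite mulmxDl raddfD /= trace_rank1 lerDl pmulr_rge0 //.
  by rewrite invr_gt0 ip_gt0.
- move=> u v Hu Hv; have [->|u0] := eqVneq u 0; first by rewrite ipC ip0r.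
  have uv : ip u v = 0 by case: PH => HT _; rewrite -Hu ip_adjl HT Hv ip0r.
  have bC : ip v (S *m u) = ip u (S *m v) by rewrite ipC ip_adjl ST.
  have uu : 0 < ip u u by rewrite ip_gt0.
  suff /eqP : ip u (S *m v) * ip u u = 0.
    by rewrite mulf_eq0 (gt_eqF uu) orbF => /eqP.
  apply: (@sqr_poly_ge0 R _ (ip v (S *m v) * ip u u - ip u (S *m u) * ip v v)).
  move=> t; set x := u + t *: v.
  have Hx : H *m x = u by rewrite mulmxDr -scalemxAr Hu Hv scaler0 addr0.
  have x0 : x != 0 by apply: contraNneq u0 => x0; rewrite -Hx x0 mulmx0.
  have xx : 0 < ip x x by rewrite ip_gt0.
  have Kx : (H - (ip u u)^-1 *: (u *m u^T)) *m x = 0.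
    rewrite mulmxBl Hx -scalemxAl -mulmxA mul_col_ip ipDr ipZr uv mulr0 addr0.
    by rewrite mul_mx_scalar scalerA mulVf ?gt_eqF // scale1r subrr.
  have := opt _ (projector_add1 (projector_sub1 PH Hu u0) Kx x0).
  rewrite mulmxDl mulmxBl raddfD raddfB /= !trace_rank1 -subr_ge0.
  rewrite -(pmulr_rge0 _ (mulr_gt0 uu xx)).
  have exx : ip x x = ip u u + t ^+ 2 * ip v v.
    rewrite /x ipDl !ipDr !ipZl !ipZr (ipC v u) uv; ring.
  have exS : ip x (S *m x) = ip u (S *m u) + 2 * t * ip u (S *m v)
                               + t ^+ 2 * ip v (S *m v).
    rewrite /x mulmxDr -scalemxAr ipDl !ipDr !ipZl !ipZr bC; ring.
  suff -> : ip u u * ip x x * (\tr (H *m S) - (ip u u)^-1 * ip u (S *m u)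
     + (ip x x)^-1 * ip x (S *m x) - \tr (H *m S)) =
     2 * t * (ip u (S *m v) * ip u u) + t ^+ 2 *
       (ip v (S *m v) * ip u u - ip u (S *m u) * ip v v) by [].
  transitivity (ip u u * ip x (S *m x) - ip x x * ip u (S *m u)).
    by field; rewrite !gt_eqF.
  by rewrite exx exS; ring.
Qed.

(** * Contractions with prescribed action *)

Definition contractive (R : realType) (d n : nat) (C : 'M[R]_(d, n)) : Prop :=
  forall x : 'cV_n, ip (C *m x) (C *m x) <= ip x x.

(** Expand [0 <= |y - C C^T y|^2] and bound [|C C^T y|] by [|C^T y|]. *)
Lemma contractive_tr (R : realType) (d n : nat) (C : 'M[R]_(d, n)) :
  contractive C -> contractive C^T.
Proof.
move=> cC y; have := cC (C^T *m y); have := ip_ge0 (y - C *m (C^T *m y)).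
rewrite ipDl !ipDr !ipNl !ipNr opprK.
rewrite (ipC y (C *m _)) [ip (C *m (C^T *m y)) y]ip_adjl.
lra.
Qed.

Lemma projector_contractive (R : realType) (m : nat) (H : 'M[R]_m) :
  projector H -> contractive H.
Proof.
move=> PH x; have := ip_ge0 (x - H *m x).
have [HT HH] := PH.
have E : ip (H *m x) (H *m x) = ip x (H *m x) by rewrite ip_adjl HT mulmxA HH.
rewrite ipDl !ipDr !ipNl !ipNr opprK E (ipC (H *m x)); lra.
Qed.

Lemma pinv_tr (R : realType) (m p : nat) (Y : 'M[R]_(m, p)) :
  pinv Y^T = (pinv Y)^T.
Proof.
apply: penrose_unique (pinvP _) _; have [Y1 Y2 Y3 Y4] := pinvP Y.
by split; rewrite -!trmx_mul ?trmxK ?mulmxA ?Y1 ?Y2 ?Y3 ?Y4.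
Qed.

(** A matrix factors through [Y] on the right exactly when it kills the kernel
    of [Y], because [1 - pinv Y *m Y] projects onto that kernel. *)
Lemma factor_pinv (R : realType) (m n p : nat) (Y : 'M[R]_(m, p))
    (X : 'M[R]_(n, p)) :
  (forall x : 'cV_p, Y *m x = 0 -> X *m x = 0) -> X *m pinv Y *m Y = X.
Proof.
move=> kerYX; have [Y1 _ _ _] := pinvP Y.
set N := pinv Y *m Y - 1%:M.
have YN : Y *m N = 0 by rewrite mulmxBr mulmx1 mulmxA Y1 subrr.
have XN : X *m N = 0.
  apply/matrixP => i j; have := kerYX (N *m delta_mx j 0).
  rewrite !mulmxA YN mul0mx -colE => /(_ erefl)/colP/(_ i).
  by rewrite [LHS]mxE [RHS]mxE => ->; rewrite mxE.
by apply/eqP; rewrite -subr_eq0 -mulmxA -{2}[X]mulmx1 -mulmxBr XN.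
Qed.

(** A contraction [C] may be prescribed on the range of [G], and its adjoint on the
    range of [K], provided both prescriptions are contractive and agree with each
    other.  The second prescription alone is met by [Z], the adjoint of
    [L *m pinv K], whose range lies in that of [K].  Any correction [T] with range
    orthogonal to [K] preserves it, and [Z + T] is a contraction as soon as
    [|T x|^2 <= ip x (D x)] for the defect form [D = 1 - Z^T Z] of [Z].  The
    correction is forced on the range of [G], where this bound holds because
    [F] is dominated by [G]; precomposing with a map that sends each vector to
    a [D]-nearest point of the range of [G] extends it to the whole space without
    losing the bound. *)
Lemma parrott (R : realType) (n d p q : nat)
    (G : 'M[R]_(n, p)) (F : 'M[R]_(d, p)) (K : 'M[R]_(d, q)) (L : 'M[R]_(n, q)) :
  (forall x : 'cV_p, ip (F *m x) (F *m x) <= ip (G *m x) (G *m x)) ->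
  (forall x : 'cV_q, ip (L *m x) (L *m x) <= ip (K *m x) (K *m x)) ->
  G^T *m L = F^T *m K ->
  exists C : 'M[R]_(d, n), [/\ contractive C, C *m G = F & C^T *m K = L].
Proof.
move=> FG LK GLFK.
pose Z := (L *m pinv K)^T.
have ZK : Z^T *m K = L.
  rewrite trmxK factor_pinv // => x Kx; apply/eqP; rewrite -ip_eq0 eq_le ip_ge0.
  by rewrite andbT (le_trans (LK x)) // Kx ip0r.
have cZ : contractive Z.
  apply: contractive_tr => y; rewrite -mulmxA (le_trans (LK _)) // mulmxA.
  exact/projector_contractive/pinv_projector.
pose D := 1%:M - Z^T *m Z.
have DT : D^T = D by rewrite /D linearB /= trmx1 trmx_mul trmxK.
have ipD (x : 'cV_n) : ip x (D *m x) = ip x x - ip (Z *m x) (Z *m x).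
  by rewrite mulmxBl mul1mx ipDr ipNr -mulmxA [in RHS]ip_adjl.
pose T0 := F - Z *m G.
have KF : K^T *m F = L^T *m G.
  by rewrite -[K^T *m F]trmxK trmx_mul trmxK -GLFK trmx_mul trmxK.
have KT0 : K^T *m T0 = 0.
  by rewrite mulmxBr KF mulmxA -ZK trmx_mul trmxK subrr.
have ZT0 : Z^T *m T0 = 0.
  have [_ K2 K3 _] := pinvP K.
  have -> : Z^T = Z^T *m (pinv K)^T *m K^T.
    by rewrite -mulmxA -trmx_mul K3 trmxK -!mulmxA (mulmxA (pinv K)) K2.
  by rewrite -mulmxA KT0 mulmx0.
(* [M] is the Gram matrix of the columns of [G] for the form [D]. *)
have [M ME] : exists M, M = G^T *m D *m G by exists (G^T *m D *m G).
have T0M (w : 'cV_p) : ip (T0 *m w) (T0 *m w) <= ip w (M *m w).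
  have -> : ip w (M *m w) = ip (G *m w) (D *m (G *m w)).
    by rewrite ME -!mulmxA [in RHS]ip_adjl.
  rewrite ipD; have FE : F *m w = T0 *m w + Z *m (G *m w).
    by rewrite /T0 mulmxBl mulmxA subrK.
  have := FG w; rewrite FE ipDl !ipDr.
  have E : ip (Z *m (G *m w)) (T0 *m w) = 0.
    by rewrite ip_adjl mulmxA ZT0 mul0mx ip0r.
  rewrite (ipC (T0 *m w) (Z *m _)) E; lra.
(* [G *m W *m x] is a point of the range of [G] nearest to [x] for [D]. *)
have [W WE] : exists W, W = pinv M *m (G^T *m D).
  by exists (pinv M *m (G^T *m D)).
have MT : M^T = M by rewrite ME !trmx_mul trmxK DT mulmxA.
have WMW : W^T *m M *m W = W^T *m (G^T *m D).
  have PT : (pinv M)^T = pinv M by rewrite -pinv_tr MT.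
  have [_ M2 _ _] := pinvP M.
  rewrite WE trmx_mul PT; move: (G^T *m D) => E.
  by rewrite mulmxA -2!(mulmxA _^T) M2.
pose T := T0 *m W.
have TG : T *m G = T0.
  rewrite /T WE -!mulmxA (mulmxA G^T) -ME mulmxA factor_pinv // => x Mx.
  apply/eqP; rewrite -ip_eq0 eq_le ip_ge0 andbT (le_trans (T0M x)) //.
  by rewrite Mx ip0r.
have KT : K^T *m T = 0 by rewrite mulmxA KT0 mul0mx.
have ZT : Z^T *m T = 0 by rewrite mulmxA ZT0 mul0mx.
have TD (x : 'cV_n) : ip (T *m x) (T *m x) <= ip x (D *m x).
  rewrite /T -mulmxA (le_trans (T0M _)) //; set w := W *m x.
  have E1 : ip w (M *m w) = ip w (G^T *m (D *m x)).
    by rewrite /w !ip_adjl (mulmxA _ D) (mulmxA _ (_ *m D)) -WMW !mulmxA.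
  set y := x - G *m w; have y0 : 0 <= ip y (D *m y).
    by rewrite ipD subr_ge0 cZ.
  (* Pythagoras for the semidefinite form [D]. *)
  suff : ip y (D *m y) = ip x (D *m x) - ip w (M *m w) by lra.
  have E2 : ip (G *m w) (D *m x) = ip w (M *m w) by rewrite ip_adjl E1.
  have E3 : ip x (D *m (G *m w)) = ip w (M *m w).
    by rewrite ipC ip_adjl DT E2.
  have E4 : ip (G *m w) (D *m (G *m w)) = ip w (M *m w).
    by rewrite ip_adjl ME !mulmxA.
  by rewrite /y mulmxBr ipDl !ipDr !ipNl !ipNr E2 E3 E4; ring.
exists (Z + T); split.
- move=> x; rewrite mulmxDl ipDl !ipDr.
  have E : ip (Z *m x) (T *m x) = 0 by rewrite ip_adjl mulmxA ZT mul0mx ip0r.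
  by have := TD x; rewrite ipD (ipC (T *m x) (Z *m x)) E; lra.
- by rewrite mulmxDl TG addrC subrK.
- rewrite linearD /= mulmxDl ZK.
  by rewrite -[T^T *m K]trmxK trmx_mul trmxK KT trmx0 addr0.
Qed.

(** * Singular value decomposition *)

Lemma orthogonal_unit_vector (R : realType) (n k : nat) (P : 'M[R]_(n, k)) :
  (k < n)%N -> exists2 p : 'cV[R]_n, ip p p = 1 & P^T *m p = 0.
Proof.
move=> kn.
have ker0 : kermx P != 0.
  by rewrite kermx_eq0 /row_free neq_ltn (leq_ltn_trans (rank_leq_col P)).
pose v := (nz_row (kermx P))^T.
have v0 : v != 0 by rewrite -(inj_eq trmx_inj) trmxK trmx0 nz_row_eq0.
have Pv : P^T *m v = 0.
  by rewrite -trmx_mul (sub_kermxP (nz_row_sub _)) trmx0.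
have vv : 0 < ip v v by rewrite ip_gt0.
exists ((Num.sqrt (ip v v))^-1 *: v); last by rewrite -scalemxAr Pv scaler0.
by rewrite ipZl ipZr mulrA -expr2 exprVn sqr_sqrtr ?ltW // mulVf ?gt_eqF.
Qed.

(** Compactness of the unit sphere of the orthogonal complement of [P]. *)
Lemma rayleigh_maximizer (R : realType) (d n k : nat)
    (C : 'M[R]_(d, n)) (P : 'M[R]_(n, k)) : (k < n)%N ->
  exists p : 'cV[R]_n, [/\ ip p p = 1, P^T *m p = 0 &
    forall x : 'cV_n, P^T *m x = 0 ->
      ip (C *m x) (C *m x) <= ip (C *m p) (C *m p) * ip x x].
Proof.
move=> kn; have [p0 p01 Pp0] := orthogonal_unit_vector P kn.
pose sph := [set v : 'rV[R]_n | ip v^T v^T = 1 /\ P^T *m v^T = 0].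
have trc : continuous_mx (fun v : 'rV[R]_n => v^T).
  by move=> i j; under eq_fun do rewrite mxE; exact: coord_continuous.
have Mc q (B : 'M[R]_(q, n)) : continuous_mx (fun v : 'rV[R]_n => B *m v^T).
  by apply: continuous_mulmx => //; exact: continuous_mx_cst.
have [||| v] := @EVT_max_rV R _ (fun v => frob (C *m v^T) ^+ 2) sph.
- by exists p0^T; rewrite /sph /= trmxK.
- apply: bounded_closed_compact.
    exists 1; split=> [|M M1 v /= [v1 _]]; first exact: num_real.
    apply: le_trans (ltW M1); rewrite [leLHS]/Num.norm /= mx_normrE.
    apply/bigmax_leP; split=> // -[i j] _ /=; rewrite ord1.
    rewrite -(@ler_pXn2r _ 2) ?nnegrE // expr1n real_normK ?num_real //.
    rewrite -v1 ipE big_ord1 (bigD1 j) //= !mxE expr2 lerDl.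
    by apply: sumr_ge0 => l _; rewrite -expr2 sqr_ge0.
  have -> : sph = (fun v : 'rV[R]_n => frob v^T ^+ 2) @^-1` [set y | y = 1]
                    `&` [set v | P^T *m v^T = 0].
    by apply/seteqP; split=> v /= []; rewrite frob_ip.
  apply: closedI; last exact: closed_mx0.
  apply: preimage_closed; last exact: closed_eq.
  by move=> v _; exact: continuous_frob_sqr.
- exact/continuous_subspaceT/continuous_frob_sqr.
rewrite inE => -[v1 Pv] vmax; exists v^T; split=> // x Px.
have [->|x0] := eqVneq x 0; first by rewrite mulmx0 !ip0r mulr0.
have xx : 0 < ip x x by rewrite ip_gt0.
have := vmax ((Num.sqrt (ip x x))^-1 *: x)^T.
rewrite inE /sph /= trmxK -!scalemxAr Px scaler0 !frob_ip !ipZl !ipZr !mulrA.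
rewrite -expr2 exprVn (sqr_sqrtr (ltW xx)) mulVf ?gt_eqF //.
move=> /(_ (conj erefl erefl)).
by rewrite mulrC ler_pdivrMr.
Qed.

(** Triples are produced one at a time: the next right singular vector [p]
    maximizes [|C x|] on the unit sphere orthogonal to the previous ones, and
    first-order optimality says that [C^T C p] is a multiple of [p].  [C] and
    [C^T] exchange the spans of the previous right and left vectors, hence also
    their orthogonal complements, in which the search therefore continues. *)
Lemma singular_triples (R : realType) (d n k : nat) (C : 'M[R]_(d, n)) :
  (k <= n)%N -> (k <= d)%N ->
  exists (P : 'M[R]_(n, k)) (Q : 'M[R]_(d, k)) (s : 'rV[R]_k),
    [/\ P^T *m P = 1%:M, Q^T *m Q = 1%:M,
        C *m P = Q *m diag_mx s & C^T *m Q = P *m diag_mx s].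
Proof.
elim: k => [|k IH] kn kd.
  by exists 0, 0, 0; split; apply/matrixP => i j; try (by case: i); case: j.
have [P [Q [s [PP QQ CP CQ]]]] := IH (ltnW kn) (ltnW kd).
have [p [p1 Pp pmax]] := rayleigh_maximizer C P kn.
set l := ip (C *m p) (C *m p) in pmax.
have QCp : Q^T *m (C *m p) = 0.
  rewrite mulmxA -[Q^T *m C]trmxK trmx_mul trmxK CQ trmx_mul -mulmxA.
  by rewrite Pp mulmx0.
have PCy y : Q^T *m y = 0 -> P^T *m (C^T *m y) = 0 :> 'cV_k.
  by move=> Qy; rewrite mulmxA -trmx_mul CP trmx_mul -mulmxA Qy mulmx0.
have CCp : C^T *m (C *m p) = l *: p.
  have [h hE] : exists h, h = C^T *m (C *m p) - l *: p by eexists.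
  have Ph : P^T *m h = 0 by rewrite hE mulmxBr PCy // -scalemxAr Pp scaler0 subr0.
  suff /eqP : ip h h = 0 by rewrite ip_eq0 hE subr_eq0 => /eqP.
  apply/eqP; rewrite -oppr_eq0; apply/eqP.
  apply: (@sqr_poly_ge0 R _ (l * ip h h - ip (C *m h) (C *m h))) => t.
  have := pmax (p + t *: h).
  rewrite mulmxDr -scalemxAr Pp Ph scaler0 addr0 => /(_ erefl).
  rewrite -subr_ge0; congr (0 <= _).
  rewrite mulmxDr -scalemxAr !ipDl !ipDr !ipZl !ipZr p1 -/l.
  rewrite (ipC (C *m h) (C *m p)) (ipC h p).
  have -> : ip (C *m p) (C *m h) = ip h h + l * ip p h.
    rewrite -[C]trmxK -ip_adjl trmxK -ipZl -ipDl; congr ip.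
    by rewrite hE subrK.
  ring.
have [q [q1 Qq Cp Cq]] : exists q : 'cV[R]_d, [/\ ip q q = 1, Q^T *m q = 0,
    C *m p = Num.sqrt l *: q & C^T *m q = Num.sqrt l *: p].
  have [Cp0|Cp0] := eqVneq (C *m p) 0.
    (* Here [C] vanishes on the whole complement of [P], so [C^T] vanishes on
       that of [Q] and any unit vector there is a left singular vector. *)
    have [q q1 Qq] := orthogonal_unit_vector Q kd; exists q.
    have l0 : l = 0 by rewrite /l Cp0 ip0r.
    rewrite Cp0 l0 sqrtr0 !scale0r; split=> //; apply/eqP; rewrite -ip_eq0.
    have /eqP : ip (C *m (C^T *m q)) (C *m (C^T *m q)) = 0.
      apply/eqP; rewrite eq_le ip_ge0 andbT.
      by rewrite (le_trans (pmax _ (PCy _ Qq))) // l0 mul0r.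
    rewrite ip_eq0 => /eqP Cq0.
    by rewrite ip_adjl trmxK Cq0 ip0r.
  have l0 : 0 < l by rewrite ip_gt0.
  have sl : Num.sqrt l != 0 by rewrite gt_eqF ?sqrtr_gt0.
  exists ((Num.sqrt l)^-1 *: (C *m p)).
  rewrite ipZl ipZr -/l mulrA -expr2 exprVn sqr_sqrtr ?ltW // mulVf ?gt_eqF //.
  rewrite -!scalemxAr QCp scaler0 scalerA mulfV // scale1r CCp scalerA.
  suff -> : (Num.sqrt l)^-1 * l = Num.sqrt l by [].
  by apply: (mulfI sl); rewrite mulVKf // -expr2 sqr_sqrtr ?ltW.
exists (row_mx p P : 'M[R]_(n, 1 + k)), (row_mx q Q : 'M[R]_(d, 1 + k)).
exists (row_mx (const_mx (Num.sqrt l)) s : 'rV[R]_(1 + k)).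
have orth m (x : 'cV[R]_m) (X : 'M[R]_(m, k)) : ip x x = 1 -> X^T *m x = 0 ->
    X^T *m X = 1%:M -> (row_mx x X)^T *m row_mx x X = 1%:M.
  move=> x1 Xx XX; rewrite tr_row_mx mul_col_row mul_col_ip x1 Xx XX.
  by rewrite -[x^T *m X]trmxK trmx_mul trmxK Xx trmx0 -scalar_mx_block.
have dm : diag_mx (row_mx (const_mx (Num.sqrt l)) s : 'rV[R]_(1 + k)) =
          block_mx (Num.sqrt l)%:M 0 0 (diag_mx s).
  by rewrite diag_mx_row diag_const_mx.
have step a b (X : 'M[R]_(a, b)) (x : 'cV_b) (Y : 'M[R]_(b, k)) (y : 'cV_a)
    (W : 'M[R]_(a, k)) : X *m x = Num.sqrt l *: y -> X *m Y = W *m diag_mx s ->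
    X *m row_mx x Y = row_mx y W *m diag_mx (row_mx (const_mx (Num.sqrt l)) s).
  move=> Xx XY; rewrite dm mul_mx_row mul_row_block !mulmx0 addr0 add0r.
  by rewrite mul_mx_scalar Xx XY.
by split; [exact: orth | exact: orth | exact: step | exact: step].
Qed.

(** With [minn n d] triples one of [P], [Q] is square, hence orthogonal, and the
    singular equations can be solved for [C]. *)
Lemma svd (R : realType) (d n : nat) (C : 'M[R]_(d, n)) :
  exists (P : 'M[R]_(n, minn n d)) (Q : 'M[R]_(d, minn n d))
         (s : 'rV[R]_(minn n d)),
    [/\ P^T *m P = 1%:M, Q^T *m Q = 1%:M & C = Q *m diag_mx s *m P^T].
Proof.
have [P [Q [s [PP QQ CP CQ]]]] := singular_triples C (geq_minl n d) (geq_minr n d).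
exists P, Q, s; split => //.
have sq a k (X : 'M[R]_(a, k)) : k = a -> X^T *m X = 1%:M -> X *m X^T = 1%:M.
  (* Transporting along [k = a] makes [X] square. *)
  by move=> e; case: _ / e X => X; exact: mulmx1C.
have /orP[/minn_idPl e|/minn_idPr e] := leq_total n d.
  by rewrite -CP -mulmxA sq ?mulmx1.
apply: trmx_inj; rewrite !trmx_mul trmxK tr_diag_mx mulmxA -CQ -mulmxA.
by rewrite sq ?mulmx1.
Qed.

(** * Pairs of vectors *)

Lemma ip_split (R : realType) (m n : nat) (H : 'M[R]_m) (x y : 'M[R]_(m, n)) :
  projector H ->
  ip x y = ip (H *m x) (H *m y) + ip ((1%:M - H) *m x) ((1%:M - H) *m y).
Proof.
move=> PH; have [HT HH] := PH; have [CT CC] := projector_compl PH.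
by rewrite !ip_adjl HT CT !mulmxA HH CC -ipDr -mulmxDl addrC subrK mul1mx.
Qed.

(** The pair under [mu] is balanced so that its difference of Gram matrices is
    [(1 - s^2) (a2 a2^T - r1 r1^T)]: the cross terms cancel.  For orthogonal [r1]
    and [a2] the projector onto the line of [r1] is then optimal, and the left-hand
    side is its value. *)
Lemma mu_pair_ge (R : realType) (m : nat) (r1 a2 : 'cV[R]_m) (s : R) :
  s ^+ 2 <= 1 -> ip r1 a2 = 0 ->
  s ^+ 2 * (ip r1 r1 + ip a2 a2) <= mu (s *: r1 + a2) (r1 + s *: a2) ^+ 2.
Proof.
move=> s1 ra; have [K PK ->] := mu_attained (s *: r1 + a2) (r1 + s *: a2).
rewrite /proj_objective; move: ra.
rewrite (ip_split r1 a2 PK) (ip_split r1 r1 PK) (ip_split a2 a2 PK).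
rewrite !mulmxDr -!scalemxAr !ipDl !ipDr !ipZl !ipZr.
rewrite (ipC (K *m a2) (K *m r1)) (ipC ((1%:M - K) *m a2) ((1%:M - K) *m r1)).
have := ip_ge0 (K *m a2); have := ip_ge0 ((1%:M - K) *m r1).
move: (ip (K *m r1) (K *m a2)) (ip (K *m a2) (K *m a2)) => u v.
move: (ip ((1%:M - K) *m r1) _) (ip _ ((1%:M - K) *m r1)) => w z z0 v0 /eqP.
rewrite addr_eq0 => /eqP ->; nra.
Qed.

(** * Upper bound and attainment *)

Lemma ip_orthonormal (R : realType) (m n k : nat) (A : 'M[R]_(m, n))
    (P : 'M[R]_(n, k)) : P^T *m P = 1%:M -> ip (A *m P) (A *m P) <= ip A A.
Proof.
move=> PP; have := ip_ge0 (A - A *m P *m P^T).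
have E : ip A (A *m P *m P^T) = ip (A *m P) (A *m P) by rewrite [RHS]ip_adjr.
have E2 : ip (A *m P *m P^T) (A *m P *m P^T) = ip (A *m P) (A *m P).
  by rewrite ip_adjr trmxK -mulmxA PP mulmx1.
rewrite ipDl !ipDr !ipNl !ipNr opprK E2 (ipC _ A) E; lra.
Qed.

Lemma sum_mu_le (R : realType) (m n d k : nat) (A : 'M[R]_(m, n))
    (B : 'M[R]_(m, d)) (P : 'M[R]_(n, k)) (Q : 'M[R]_(d, k)) :
  P^T *m P = 1%:M -> Q^T *m Q = 1%:M ->
  \sum_(i < k) mu (A *m col i P) (B *m col i Q) ^+ 2 <= mu A B ^+ 2.
Proof.
move=> PP QQ; have [H PH ->] := mu_attained A B.
apply: le_trans (lerD (ip_orthonormal (H *m A) PP)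
                      (ip_orthonormal ((1%:M - H) *m B) QQ)).
rewrite (ip_col (H *m A *m P)) (ip_col ((1%:M - H) *m B *m Q)) -big_split /=.
apply: ler_sum => i _; rewrite !colE -!(mulmxA _ _ (delta_mx i 0)) -!colE.
rewrite -!(mulmxA H) -!(mulmxA (1%:M - H)).
exact: mu_le_objective.
Qed.

(** The signature of [A A^T - B B^T] relative to an optimal [H] is what [parrott]
    needs for the transposed blocks [A^T H'], [B^T H'], [B^T H], [A^T H]. *)
Lemma optimal_contraction (R : realType) (m n d : nat) (A : 'M[R]_(m, n))
    (B : 'M[R]_(m, d)) :
  exists (H : 'M[R]_m) (C : 'M[R]_(d, n)),
    [/\ projector H, mu A B ^+ 2 = proj_objective A B H, contractive C,
        H *m A = H *m B *m C & (1%:M - H) *m B = (1%:M - H) *m A *m C^T].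
Proof.
have [H PH muH] := mu_attained A B; have [HT HH] := PH.
have [CT CC] := projector_compl PH.
pose S := A *m A^T - B *m B^T.
have ST : S^T = S by rewrite linearB /= !trmx_mul !trmxK.
have ipS (x y : 'cV[R]_m) : ip x (S *m y) = ip (A^T *m x) (A^T *m y)
                                  - ip (B^T *m x) (B^T *m y).
  by rewrite mulmxBl ipDr ipNr !ip_adjl !trmxK !mulmxA.
have opt K : projector K -> \tr (H *m S) <= \tr (K *m S).
  move=> PK; have := mu_le_objective A B PK.
  by rewrite muH !proj_objectiveE // lerD2l.
have [Sneg Spos Szero] := optimal_signature PH ST opt.
have HHx (x : 'cV[R]_m) : H *m (H *m x) = H *m x by rewrite mulmxA HH.
have HCx (x : 'cV[R]_m) : H *m ((1%:M - H) *m x) = 0.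
  by rewrite mulmxA mulmxBr mulmx1 HH subrr mul0mx.
have [|||C [cC CG CK]] := @parrott R n d m m
  (A^T *m (1%:M - H)) (B^T *m (1%:M - H)) (B^T *m H) (A^T *m H).
- by move=> x; rewrite -!mulmxA -subr_ge0 -ipS Spos.
- by move=> x; rewrite -!mulmxA -subr_le0 -ipS Sneg.
- apply/eqP; rewrite -subr_eq0; apply/eqP.
  rewrite !trmx_mul !trmxK CT -!mulmxA -mulmxBr !(mulmxA _ _ H) -mulmxBl -/S.
  apply/matrixP => i j; rewrite [RHS]mxE.
  (* Entry [(i, j)] is the decoupling condition at columns [j], [i]. *)
  have := Szero (H *m delta_mx j 0) ((1%:M - H) *m delta_mx i 0) (HHx _) (HCx _).
  rewrite ipC ip_adjl ST ip_adjl CT.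
  rewrite /ip trmx_delta -rowE trace_mx11 mxE !mulmxA -colE mxE.
  by rewrite -!mulmxA.
exists H, C; split => //.
  by rewrite -[LHS]trmxK trmx_mul HT -CK !trmx_mul !trmxK HT.
by rewrite -[LHS]trmxK trmx_mul CT -CG !trmx_mul !trmxK CT.
Qed.

Lemma sum_mu_attained (R : realType) (m n d : nat) (A : 'M[R]_(m, n))
    (B : 'M[R]_(m, d)) :
  exists (P : 'M[R]_(n, minn n d)) (Q : 'M[R]_(d, minn n d)),
    [/\ P^T *m P = 1%:M, Q^T *m Q = 1%:M &
        mu A B ^+ 2 <= \sum_(i < minn n d) mu (A *m col i P) (B *m col i Q) ^+ 2].
Proof.
have [H [C [PH -> cC HA HB]]] := optimal_contraction A B; have [HT HH] := PH.
have [P [Q [s [PP QQ CE]]]] := svd C; exists P, Q; split => //.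
have CP : C *m P = Q *m diag_mx s by rewrite CE -mulmxA PP mulmx1.
have CQ : C^T *m Q = P *m diag_mx s.
  by rewrite CE !trmx_mul trmxK tr_diag_mx -!mulmxA QQ mulmx1.
have colD a (X : 'M[R]_(a, minn n d)) i : col i (X *m diag_mx s) = s 0 i *: col i X.
  by apply/colP => j; rewrite mul_mx_diag !mxE mulrC.
have mulcol a b (X : 'M[R]_(a, b)) (Y : 'M[R]_(b, minn n d)) i :
    col i (X *m Y) = X *m col i Y by rewrite !colE mulmxA.
(* Since [C = C P P^T], passing to [P] loses nothing of [H A = H B C]. *)
have HAP : ip (H *m A) (H *m A) <= ip (H *m A *m P) (H *m A *m P).
  have {1}<- : H *m A *m P *m P^T = H *m A.
    by rewrite HA -(mulmxA _ C P) CP -(mulmxA _ _ P^T) -CE.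
  by rewrite ip_adjr trmxK.
have HBQ : ip ((1%:M - H) *m B) ((1%:M - H) *m B) <=
           ip ((1%:M - H) *m B *m Q) ((1%:M - H) *m B *m Q).
  have {1}<- : (1%:M - H) *m B *m Q *m Q^T = (1%:M - H) *m B.
    rewrite HB -(mulmxA _ C^T Q) CQ -(mulmxA _ _ Q^T).
    by rewrite [in RHS]CE !trmx_mul trmxK tr_diag_mx !mulmxA.
  by rewrite ip_adjr trmxK.
apply: le_trans (lerD HAP HBQ) _.
rewrite (ip_col (H *m A *m P)) (ip_col ((1%:M - H) *m B *m Q)) -big_split /=.
apply: ler_sum => i _.
pose r1 := H *m (B *m col i Q); pose a2 := (1%:M - H) *m (A *m col i P).
have a1E : H *m (A *m col i P) = s 0 i *: r1.
  by rewrite mulmxA HA -!mulmxA -(mulcol _ _ C) CP colD -!scalemxAr.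
have r2E : (1%:M - H) *m (B *m col i Q) = s 0 i *: a2.
  by rewrite mulmxA HB -!mulmxA -(mulcol _ _ C^T) CQ colD -!scalemxAr.
have dec (x : 'cV[R]_m) : x = H *m x + (1%:M - H) *m x.
  by rewrite -mulmxDl addrC subrK mul1mx.
have unitcol a (X : 'M[R]_(a, minn n d)) :
    X^T *m X = 1%:M -> ip (col i X) (col i X) = 1.
  move=> XX; rewrite colE ip_adjl mulmxA XX mul1mx /ip trmx_delta.
  by rewrite mul_delta_mx trace_mx11 mxE !eqxx.
have s1 : s 0 i ^+ 2 <= 1.
  have := cC (col i P); rewrite -mulcol CP colD ipZl ipZr !unitcol // mulr1.
  by rewrite expr2.
have ra : ip r1 a2 = 0.
  by rewrite ip_adjl HT mulmxA mulmxBr mulmx1 HH subrr mul0mx ip0r.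
rewrite (dec (A *m col i P)) (dec (B *m col i Q)) a1E r2E.
apply: le_trans (mu_pair_ge s1 ra).
rewrite -!mulmxA !mulcol a1E r2E !ipZl !ipZr; lra.
Qed.

Theorem theorem1 (R : realType) (m n d : nat)
    (m_gt0 : (0 < m)%N) (n_gt0 : (0 < n)%N) (d_gt0 : (0 < d)%N)
    (A : 'M[R]_(m, n)) (Rtheta : 'M[R]_(m, d)) :
  is_maximum
    [set x : R | exists (P : 'M[R]_(n, minn n d)) (Q : 'M[R]_(d, minn n d)),
       [/\ P^T *m P = 1%:M,
           Q^T *m Q = 1%:M &
           x = Num.sqrt (\sum_(i < minn n d)
                 mu (A *m col i P) (Rtheta *m col i Q) ^+ 2)]]
    (mu A Rtheta).
Proof.
have sqrt_mu : mu A Rtheta = Num.sqrt (mu A Rtheta ^+ 2).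
  by rewrite sqrtr_sqr ger0_norm ?mu_ge0.
split.
  have [P [Q [PP QQ le]]] := sum_mu_attained A Rtheta; exists P, Q; split => //.
  rewrite [LHS]sqrt_mu; congr Num.sqrt; apply/le_anti.
  by rewrite le sum_mu_le.
move=> _ [P [Q [PP QQ ->]]]; rewrite sqrt_mu ler_wsqrtr //.
exact: sum_mu_le.
Qed.
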